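(* Let $\mathsf P$ be a one-move rider with basic move $(c,d)$ and let $q\ge2$. Then $u_{\mathsf P}(q;n)$, as a quasipolynomial function of $n$, has period $\max(|c|,|d|)$.
   Context: A one-move rider has a single basic move $(c,d)\in\mathbb Z^2\setminus\{0\}$ with $\gcd(c,d)=1$. Pieces are placed on the $n\times n$ board $[n]^2=\{1,\dots,n\}^2$; two pieces at positions $z,z'$ attack each other if $z'-z$ is an integer multiple of $(c,d)$ (in particular if $z=z'$). $u_{\mathsf P}(q;n)$ is the number of ways to place $q$ unlabelled pieces on $[n]^2$ with no two attacking each other; it is a quasipolynomial in $n$, and its period is the least $p$ such that it is given by polynomials in $n$ depending only on $n \bmod p$. *)

(* Defs.v *)
From mathcomp Require Import all_boot all_order all_algebra.
From mathcomp Require Import boolp.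
Set Implicit Arguments. Unset Strict Implicit. Unset Printing Implicit Defensive.
Import Order.TTheory GRing.Theory Num.Theory.
Local Open Scope ring_scope.

(* A square of the n x n board [n]^2: (i, j) : 'I_n * 'I_n stands for the
   square (i+1, j+1) in {1..n}^2.  Attacking only depends on differences, so
   the shift by one is immaterial. *)
Definition square (n : nat) := ('I_n * 'I_n)%type.

Definition attacks (c d : int) (n : nat) (z z' : square n) : Prop :=
  exists k : int,
    (z'.1 : nat)%:Z - (z.1 : nat)%:Z = k * c /\
    (z'.2 : nat)%:Z - (z.2 : nat)%:Z = k * d.

Definition nonattacking (c d : int) (q n : nat) (S : {set square n}) : Prop :=
  #|S| = q /\
  forall z z', z \in S -> z' \in S -> z != z' -> ~ attacks c d z z'.

Definition u_rider (c d : int) (q n : nat) : nat :=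
  #|[set S : {set square n} | `[< nonattacking c d q S >] ]|.

Definition quasipoly_with_period (f : nat -> nat) (p : nat) : Prop :=
  (0 < p)%N /\
  exists F : nat -> {poly rat},
    forall n : nat, (0 < n)%N -> (f n)%:R = (F (n %% p)%N).[n%:R].

Definition quasipoly_period (f : nat -> nat) (p : nat) : Prop :=
  quasipoly_with_period f p /\
  forall p', quasipoly_with_period f p' -> (p <= p')%N.

(* Main.v *)
Require Import Defs.
From mathcomp Require Import all_boot all_order all_algebra.
From mathcomp Require Import boolp zify ring.
Set Implicit Arguments. Unset Strict Implicit. Unset Printing Implicit Defensive.
Import Order.TTheory GRing.Theory Num.Theory.

(** By symmetry let [0 <= c <= d]. A nonattacking placement picks [q] distinct
    lines in direction [(c, d)] and one square on each, so [u] is the [q]-th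
    elementary symmetric function of the line sizes. A Newton-type recursion
    expresses it through the power sums [p_j] of these sizes, and, by second
    differences, [p_j] is the sum over [0 <= t <= n / d] of
    [(n - t c) (n - t d)] times a polynomial in [t]. Hence, for [n = k d + r], the
    count is a polynomial in [n] depending only on [r].

    With [rho = r / d], passing from residue [0] to [r] does not change [p_1],
    changes [p_2] by [(d - c) rho (1 - rho) n] plus a constant, and changes [p_j]
    in degree at most [j - 1]. In the recursion only [p_2] matters at the leading
    order: for [0 < r < d] the difference of the constituents of [r] and [0] has
    degree [2 q - 3] and a negative leading coefficient. If [p < d] were a
    period, the constituents of [0] and [p] would both coincide with the one of
    the class of [0] mod [p]. *)

(** * Transversals of the classes of a finite partition *)

Section Transversals.
Variables (T : finType) (L : eqType) (cl : T -> L).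

Definition indep (S : {set T}) :=
  [forall x in S, forall y in S, (cl x == cl y) ==> (x == y)].

Definition csize x := #|[set y | cl y == cl x]|.

Definition indep_count q := #|[set S | indep S & #|S| == q]|.

(* As in Newton's identities: the weights interpolate between [indep_count q] and
   its products with the power sums [\sum_x csize x ^ i], which are the sums of
   the [i.+1]-st powers of the class sizes. *)
Definition indep_weight q i :=
  \sum_x csize x ^ i * #|[set S | [&& indep S, #|S| == q & x \in S]]|.

Lemma indepP (S : {set T}) :
  reflect {in S &, injective cl} (indep S).
Proof.
apply: (iffP forall_inP) => [h x y xS yS exy | h x xS].
  by have /forall_inP/(_ y yS)/implyP := h x xS; rewrite exy eqxx => /(_ isT)/eqP.
by apply/forall_inP => y yS; apply/implyP => /eqP/h ->.
Qed.

Lemma eq_csize x y : cl x = cl y -> csize x = csize y.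
Proof. by rewrite /csize => ->. Qed.

Lemma csize_gt0 x : 0 < csize x.
Proof. by apply/card_gt0P; exists x; rewrite inE. Qed.

Lemma indep_weight0 i : indep_weight 0 i = 0.
Proof.
apply: big1 => x _; apply/eqP; rewrite muln_eq0 cards_eq0; apply/orP; right.
apply/eqP/setP => S; rewrite !inE; apply/and3P => -[_]; rewrite cards_eq0.
by move=> /eqP ->; rewrite inE.
Qed.

Lemma indep_count0 : indep_count 0 = 1.
Proof.
rewrite -(cards1 (set0 : {set T})); apply: eq_card => S.
rewrite !inE cards_eq0; case: eqP => [->|]; rewrite ?andbF // andbT.
by apply/indepP => x y; rewrite inE.
Qed.

(** Double counting of the pairs [x \in S]. This closes the recursion by recovering the count from
    the weights. *)
Lemma indep_weight_exp0 q : indep_weight q 0 = q * indep_count q.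
Proof.
rewrite /indep_weight.
under eq_bigr => x _ do rewrite mul1n -sum1_card big_mkcond.
rewrite exchange_big /= mulnC /indep_count -sum_nat_const [RHS]big_mkcond /=.
apply: eq_bigr => S _; rewrite -big_mkcond /= !inE.
case: ifP => [/andP[iS /eqP<-]|nS].
  by rewrite -[RHS]sum1_card; apply: eq_bigl => x; rewrite inE iS eqxx.
by apply: big_pred0 => x; rewrite inE andbA nS.
Qed.

(** Adjoining [x] to a transversal that misses its class is a bijection, with inverse the removal of
    [x]. *)
Lemma card_indep_extend q x :
  #|[set S | [&& indep S, #|S| == q & [forall y in S, cl y != cl x]]]| =
  #|[set S | [&& indep S, #|S| == q.+1 & x \in S]]|.
Proof.
set A := [set S | _]; set B := [set S | _].
have xA S : S \in A -> x \notin S.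
  rewrite inE => /and3P[_ _ /forall_inP h]; apply/negP => /h.
  by rewrite eqxx.
suff <- : (fun S : {set T} => x |: S) @: A = B.
  rewrite card_in_imset // => S S' /xA xS /xA xS' e.
  by rewrite -(setU1K xS) e setU1K.
apply/setP => S; apply/imsetP/idP => [[S' S'A ->]|].
  have xS' := xA _ S'A; move: S'A; rewrite !inE cardsU1 xS' eqxx /=.
  case/and3P => /indepP iS /eqP -> /forall_inP h; rewrite add1n eqxx !andbT.
  apply/indepP => u v; rewrite !inE => /orP[/eqP->|uS] /orP[/eqP->|vS] //.
  - by move/eqP; rewrite eq_sym (negPf (h _ vS)).
  - by move/eqP; rewrite (negPf (h _ uS)).
  - exact: iS.
rewrite inE => /and3P[/indepP iS cS xS]; exists (S :\ x); last by rewrite setD1K.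
rewrite inE; apply/and3P; split.
- by apply/indepP => u v; rewrite !inE => /andP[_ uS] /andP[_ vS]; apply: iS.
- by move: cS; rewrite (cardsD1 x) xS.
- apply/forall_inP => y; rewrite !inE => /andP[nyx yS].
  by apply: contraNneq nyx => /iS ->.
Qed.

(** A transversal either misses the class of [x] or meets it in exactly one element [y]. *)
Lemma indep_split q x :
  indep_count q =
  #|[set S | [&& indep S, #|S| == q & [forall y in S, cl y != cl x]]]| +
  \sum_(y | cl y == cl x) #|[set S | [&& indep S, #|S| == q & y \in S]]|.
Proof.
rewrite /indep_count -!sum1_card.
under [X in _ = _ + X]eq_bigr => y _ do rewrite -sum1_card big_mkcond.
rewrite [X in _ = _ + X]exchange_big /= [in LHS]big_mkcond /=.
rewrite [X in _ = X + _]big_mkcond /= -big_split /=; apply: eq_bigr => S _.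
rewrite !inE; have [iS|nS] /= := boolP (indep S); last first.
  by rewrite big1 // => y _; rewrite inE (negPf nS).
under eq_bigr => y _ do rewrite inE.
case: (#|S| == q) => /=; last by rewrite big1 // => y _; rewrite iS.
rewrite iS /= -big_mkcondr /=.
case: (boolP [forall y in S, cl y != cl x]) => [/forall_inP h|/forall_inPn[y yS]].
  by rewrite big_pred0 // => y; apply/andP => -[e /h]; rewrite e.
rewrite negbK => /eqP exy.
rewrite (big_pred1 y) // => z; apply/andP/eqP => [[/eqP e zS]|->].
  by move/indepP: iS; apply => //; rewrite e.
by rewrite exy.
Qed.

(** Apply [indep_split] at each [x]. Sets missing the class of [x] extend by [x]; a set meeting it
    in [y] is found once for every [x] in the class of [y], whence one more factor [csize y]. *)
Lemma indep_weight_rec q i :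
  indep_count q * (\sum_x csize x ^ i) =
  indep_weight q.+1 i + indep_weight q i.+1.
Proof.
rewrite big_distrr /=.
under eq_bigr => x _ do rewrite (indep_split q x) mulnDl card_indep_extend mulnC.
rewrite big_split; congr (_ + _).
under eq_bigr => x _ do rewrite big_distrl /= big_mkcond.
rewrite exchange_big /=; apply: eq_bigr => y _.
rewrite -big_mkcond /= -big_distrr /= mulnC; congr (_ * _).
rewrite expnS -[X in X * _]sum1_card big_distrl /=.
apply: eq_big => [x|x]; first by rewrite inE eq_sym.
by move=> /eqP/eq_csize ->; rewrite mul1n.
Qed.

Local Open Scope ring_scope.

(* Within a class of size s, [a] takes each of the values 0, ..., s - 1 once, so
   the summand on the right telescopes to [s ^ j.+1] over the class. *)
Lemma sum_csize_rank (a : T -> nat) j :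
    (forall x, a x < csize x)%N ->
    (forall x y, cl x = cl y -> a x = a y -> x = y) ->
  \sum_x ((csize x ^ j)%N%:R : rat) =
  \sum_x ((a x).+1%:R ^+ j.+1 - (a x)%:R ^+ j.+1).
Proof.
move=> ltas inja; pose phi m : rat := m.+1%:R ^+ j.+1 - m%:R ^+ j.+1.
have class_sum x :
    \sum_(y | cl y == cl x) phi (a y) = (csize x)%:R ^+ j.+1.
  have -> : \sum_(y | cl y == cl x) phi (a y) = \sum_(0 <= m < csize x) phi m.
    rewrite -big_filter -(big_map a xpredT); apply: perm_big.
    set s := [seq _ | _ <- _]; have us : uniq s.
      rewrite map_inj_in_uniq ?filter_uniq ?index_enum_uniq // => u v.
      rewrite !mem_filter => /andP[/eqP eu _] /andP[/eqP ev _].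
      by apply: inja; rewrite eu.
    have ss : size s = csize x.
      rewrite size_map -sum1_size big_filter /csize -sum1_card.
      by apply: eq_bigl => y; rewrite inE.
    apply: uniq_perm => //; first exact: iota_uniq.
    apply: (uniq_min_size us _ _).2; last by rewrite size_iota ss subn0.
    move=> m /mapP[y]; rewrite mem_filter => /andP[/eqP ey _] ->.
    by rewrite mem_index_iota -(eq_csize ey) ltas.
  by rewrite telescope_sumr // expr0n subr0.
(* The class sum [csize x ^ j.+1] is shared equally among the elements of the class; exchanging the
   sums then cancels the division. *)
transitivity (\sum_x \sum_(y | cl y == cl x) phi (a y) / (csize x)%:R).
  apply: eq_bigr => x _; rewrite -mulr_suml class_sum exprSr mulfK ?natrX //.
  by rewrite pnatr_eq0 -lt0n csize_gt0.
under eq_bigr => x _ do rewrite big_mkcond.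
rewrite exchange_big /=; apply: eq_bigr => y _.
rewrite -big_mkcond /= (eq_bigr (fun=> phi (a y) / (csize y)%:R)); last first.
  by move=> x /eqP/eq_csize ->.
rewrite sumr_const -[RHS]/(phi (a y)).
have -> : #|[pred x | cl y == cl x]| = csize y.
  by apply: eq_card => x; rewrite !inE eq_sym.
by rewrite -[LHS]mulr_natr divfK // pnatr_eq0 -lt0n csize_gt0.
Qed.

End Transversals.

Local Open Scope ring_scope.

(** * Lines of the board *)

Section RiderLines.
Variables (c d n : nat).
Hypotheses (d_gt0 : (0 < d)%N) (co_cd : coprime c d).

Definition line (z : square n) : int := d%:Z * (z.1 : nat)%:Z - c%:Z * (z.2 : nat)%:Z.

(** Equal values of the linear form make [d] divide [c] times the second difference, hence, by
    coprimality, that difference itself; the quotient is the multiplier [k]. *)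
Lemma attacksE (z z' : square n) : attacks c d z z' <-> line z = line z'.
Proof.
rewrite /attacks /line; split=> [[k [e1 e2]]|e]; first by nia.
have e' : d%:Z * (z'.1%:Z - z.1%:Z) = c%:Z * (z'.2%:Z - z.2%:Z) by lia.
have : (d %| c%:Z * (z'.2%:Z - z.2%:Z))%Z by rewrite -e' dvdz_mulr.
rewrite Gauss_dvdzr; last by rewrite /coprimez /gcdz /= gcdnC.
case/dvdzP => k ek; exists k; split=> //.
have dN0 : d%:Z != 0 by rewrite eqz_nat -lt0n.
by apply: (mulfI dN0); rewrite e' ek; ring.
Qed.

Lemma u_riderE q : u_rider c d q n = indep_count line q.
Proof.
apply: eq_card => S; rewrite !inE; apply/asboolP/andP => [[cS nS]|[/indepP iS /eqP cS]].
  split; last exact/eqP.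
  apply/indepP => x y xS yS e; apply: contrapT => /eqP nxy.
  by apply: (nS x y xS yS nxy); apply/attacksE.
split=> // x y xS yS nxy /attacksE/(iS _ _ xS yS) e.
by rewrite e eqxx in nxy.
Qed.

Definition fits t (z : square n) := (z.1 + t * c < n)%N && (z.2 + t * d < n)%N.

(** This is the rank fed to [sum_csize_rank]: the position of [z] on its line, counted back from the
    last square. As [d > 0], the bound on [t] loses nothing. *)
Definition steps (z : square n) := (\max_(t < n.+1 | fits t z) t)%N.

Lemma stepsP t z : (t <= steps z)%N = fits t z.
Proof.
apply/idP/idP => [le_t|ft].
  have f0 : fits (ord0 : 'I_n.+1) z by rewrite /fits /= !mul0n !addn0 !ltn_ord.
  have fits_nonempty : (0 < #|[pred u : 'I_n.+1 | fits u z]|)%N.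
    by apply/card_gt0P; exists ord0.
  have [u fu eu] := eq_bigmax_cond (fun u : 'I_n.+1 => u : nat) fits_nonempty.
  move: fu; rewrite inE /fits => /andP[f1 f2].
  have le_tu : (t <= u)%N by rewrite -eu.
  by apply/andP; split; nia.
have lt_t : (t < n.+1)%N by move: ft => /andP[_ h]; nia.
exact: (@leq_bigmax_cond _ (fun t : 'I_n.+1 => fits t z) (fun t : 'I_n.+1 => t : nat)
  (Ordinal lt_t)).
Qed.

Lemma fits_fst t z : (t <= steps z)%N -> (z.1 + t * c < n)%N.
Proof. by rewrite stepsP => /andP[]. Qed.

Lemma fits_snd t z : (t <= steps z)%N -> (z.2 + t * d < n)%N.
Proof. by rewrite stepsP => /andP[]. Qed.

Lemma steps_lt_csize z : (steps z < csize line z)%N.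
Proof.
pose g (t : 'I_(steps z).+1) : square n :=
  (Ordinal (fits_fst (leq_ord t)), Ordinal (fits_snd (leq_ord t))).
have ginj : injective g.
  move=> t u /(congr1 (fun z : square n => val z.2)) /= e.
  by apply: val_inj => /=; nia.
rewrite -[leqLHS]card_ord -(card_imset _ ginj); apply: subset_leq_card.
apply/subsetP => _ /imsetP[t _ ->]; rewrite inE /line /=; apply/eqP.
by rewrite !PoszD !PoszM; ring.
Qed.

Lemma steps_inj z z' : line z = line z' -> steps z = steps z' -> z = z'.
Proof.
move=> /attacksE[k [e1 e2]] es.
suff k0 : k = 0.
  move: e1 e2; rewrite k0; case: z z' {es} => x y [x' y'] /= e1 e2.
  by congr (_, _); apply: val_inj => /=; lia.
have fz := stepsP _ z; have fz' := stepsP _ z'.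
(* If one square lies [k.+1] moves ahead of the other, the rear one has at least [k.+1] more steps
   left. *)
case: k e1 e2 => [[//|k]|k] e1 e2.
  suff : (steps z' + k.+1 <= steps z)%N by lia.
  have := leqnn (steps z'); rewrite fz fz' /fits => /andP[f1 f2].
  by apply/andP; split; nia.
suff : (steps z + k.+1 <= steps z')%N by lia.
have := leqnn (steps z); rewrite fz fz' /fits => /andP[f1 f2].
by rewrite NegzE in e1 e2; apply/andP; split; nia.
Qed.

Lemma card_fits t : #|[set z | fits t z]| = ((n - t * c) * (n - t * d))%N.
Proof.
have card_lt m : #|[set i : 'I_n | (i + m < n)%N]| = (n - m)%N.
  rewrite -[RHS]card_ord -!sum1_card.
  rewrite -(big_ord_narrow (F := fun=> 1%N) (leq_subr m n)) /=.
  by apply: eq_bigl => i; rewrite inE; lia.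
rewrite -(card_lt (t * c)%N) -(card_lt (t * d)%N) -cardsX.
by apply: eq_card => z; rewrite !inE.
Qed.

(* The last term corrects the second difference at [t = 0], where the power of
   [t - 1] has to be read as 0. *)
Definition second_diff J (t : nat) : rat :=
  t.+1%:R ^+ J - 2 * t%:R ^+ J + (t%:R - 1) ^+ J - (t == 0%N)%:R * (-1) ^+ J.

Lemma sum_second_diff j m :
  \sum_(t < m.+1) second_diff j.+1 t = m.+1%:R ^+ j.+1 - m%:R ^+ j.+1.
Proof.
elim: m => [|m IH].
  by rewrite big_ord1 /second_diff eqxx expr0n sub0r /=; ring.
by rewrite big_ord_recr /= IH /second_diff /= mul0r subr0 -natr1 addrK; ring.
Qed.

(** Summation by parts: the first difference at [steps z] is a sum of second differences over all
    [t] that fit [z]; exchanging the sums leaves, for each [t], the number of squares it fits. *)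
Lemma sum_csize_fits j :
  \sum_z ((csize line z ^ j)%N%:R : rat) =
  \sum_(t < n.+1) ((n - t * c) * (n - t * d))%N%:R * second_diff j.+1 t.
Proof.
rewrite (sum_csize_rank _ steps_lt_csize); last exact: steps_inj.
transitivity (\sum_z \sum_(t < n.+1) if fits t z then second_diff j.+1 t else 0).
  apply: eq_bigr => z _; rewrite -sum_second_diff -big_mkcond /=.
  have le_s : (steps z < n.+1)%N.
    by have := leqnn (steps z); rewrite stepsP => /andP[_]; nia.
  rewrite (big_ord_widen _ (fun t => second_diff j.+1 t) le_s).
  by apply: eq_bigl => t; rewrite ltnS stepsP.
rewrite exchange_big /=; apply: eq_bigr => t _.
by rewrite -big_mkcond -card_fits mulr_natl -sumr_const; apply: eq_bigl => z; rewrite inE.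
Qed.

End RiderLines.

Lemma power_sum_csize (c d k r j : nat) (n := (k * d + r)%N) :
    (c <= d)%N -> (r < d)%N -> coprime c d ->
  \sum_(z : square n) ((csize (@line c d n) z ^ j)%N%:R : rat) =
  \sum_(t < k.+1) (n%:R - t%:R * c%:R) * (n%:R - t%:R * d%:R) *
     (t.+1%:R ^+ j.+1 - 2 * t%:R ^+ j.+1 + (t%:R - 1) ^+ j.+1)
  - (-1) ^+ j.+1 * n%:R ^+ 2.
Proof.
move=> le_cd lt_rd co; have d_gt0 : (0 < d)%N by lia.
rewrite sum_csize_fits //.
have le_kn : (k.+1 <= n.+1)%N by rewrite /n; nia.
rewrite (bigID (fun t : 'I_n.+1 => t < k.+1)%N) /= [X in _ + X]big1 => [|t]; last first.
  (* For [t > k] truncated subtraction gives 0. For [t <= k] it is exact in both factors, because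
     [c <= d]. *)
  rewrite -leqNgt => lt_kt; rewrite (_ : n - t * d = 0)%N ?muln0 ?mul0r //.
  by have := leq_mul lt_kt (leqnn d); rewrite mulSn /n; lia.
rewrite addr0 -(big_ord_widen _
  (fun t => ((n - t * c) * (n - t * d))%N%:R * second_diff j.+1 t) le_kn).
rewrite [in LHS]big_ord_recl [in RHS]big_ord_recl /= /second_diff eqxx.
rewrite (_ : \sum_(i < k) _ = \sum_(i < k) (n%:R - (bump 0 i)%:R * c%:R) *
   (n%:R - (bump 0 i)%:R * d%:R) * ((bump 0 i).+1%:R ^+ j.+1 - 2 * (bump 0 i)%:R ^+ j.+1 +
   ((bump 0 i)%:R - 1) ^+ j.+1)); last first.
  apply: eq_bigr => t _; rewrite /bump add1n /= mul0r subr0; congr (_ * _).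
  have lt_t := ltn_ord t.
  by rewrite natrM !natrB ?natrM // /n; nia.
rewrite !mul0n !subn0 natrM sub0r [true%:R]/=.
by move: (\sum_(i < k) _) => s; ring.
Qed.

(** * Constituent polynomials *)

Lemma poly_eq_infinite (p q : {poly rat}) (f : nat -> rat) :
  injective f -> (forall k, p.[f k] = q.[f k]) -> p = q.
Proof.
move=> finj epq; apply/eqP; rewrite -subr_eq0; apply/eqP.
apply: (@roots_geq_poly_eq0 _ _ [seq f k | k <- iota 0 (size (p - q))]).
- by apply/allP => _ /mapP[k _ ->]; rewrite rootE !hornerE epq subrr.
- by rewrite map_inj_uniq ?iota_uniq.
- by rewrite size_map size_iota.
Qed.

(** * Discrete antiderivatives of powers *)

Definition antidiff_spec (A : {poly rat}) a :=
  (size A <= a.+2)%N /\ forall y, A.[y] - A.[y - 1] = y ^+ a.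

(** The backward difference of [y ^+ a.+1] is [a.+1%:R * y ^+ a] plus lower powers, which strong
    induction corrects. *)
Lemma antidiff_exists a : exists A, antidiff_spec A a.
Proof.
elim/ltn_ind: a => a IH.
have /choice[B specB] : forall i : 'I_a, exists A, antidiff_spec A i.
  by move=> i; apply: IH.
exists (a.+1%:R^-1 *: ('X^(a.+1) +
  \sum_(i < a) ((-1) ^+ (a.+1 - i) * 'C(a.+1, i)%:R) *: B i)); split.
  apply: leq_trans (size_scale_leq _ _) _.
  apply: leq_trans (size_polyD _ _) _; rewrite geq_max size_polyXn leqnn /=.
  apply: leq_trans (size_sum _ _ _) _; apply/bigmax_leqP => i _.
  apply: leq_trans (size_scale_leq _ _) _.
  by apply: leq_trans (specB i).1 _; have := ltn_ord i; lia.
move=> y; rewrite !hornerE !horner_sum -mulrBr.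
apply: (canLR (mulKf _)); first by rewrite pnatr_eq0.
rewrite opprD addrACA -sumrB.
under eq_bigr => i _ do rewrite !hornerZ -mulrBr (specB i).2.
rewrite [y - 1]addrC exprDn !big_ord_recr /= subnn expr0 mul1r binn.
rewrite subSnn binSn expr1 -mulr_natl opprD addrC.
rewrite (_ : \sum_(i < a) (-1) ^+ (a.+1 - i) * y ^+ i *+ 'C(a.+1, i) =
   \sum_(i < a) (-1) ^+ (a.+1 - i) * 'C(a.+1, i)%:R * y ^+ i); last first.
  by apply: eq_bigr => i _; rewrite -mulr_natr mulrAC.
by rewrite -natr1; ring.
Qed.

(** The antiderivative of the first power is made explicit because [coef1_period_defect] evaluates
    it. *)
Lemma antidiff_family : exists A : nat -> {poly rat},
  (forall a, antidiff_spec (A a) a) /\ A 1%N = 2^-1 *: ('X^2 + 'X).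
Proof.
have [A specA] := choice antidiff_exists.
exists (fun a => if a == 1%N then 2^-1 *: ('X^2 + 'X) else A a); split=> // a.
case: eqP => [->|_]; last exact: specA.
split=> [|y]; last first.
  by rewrite !hornerZ !hornerD !hornerXn !hornerX expr1; field.
apply: leq_trans (size_scale_leq _ _) _.
by apply: leq_trans (size_polyD _ _) _; rewrite size_polyXn size_polyX.
Qed.

Lemma sum_shifted_powers (A : {poly rat}) a rho k : antidiff_spec A a ->
  \sum_(l < k.+1) (l%:R + rho) ^+ a = A.[k%:R + rho] - A.[rho - 1].
Proof.
move=> [_ dA]; elim: k => [|k IH]; first by rewrite big_ord1 -dA !add0r.
rewrite big_ord_recr /= IH -dA -natr1.
by rewrite [k%:R + 1 + rho]addrAC addrK addrC subrKA.
Qed.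

Lemma size_prod_leq (p q : {poly rat}) a b :
  (size p <= a.+1 -> size q <= b -> size (p * q)%R <= a + b)%N.
Proof. by move=> hp hq; have := size_polyMleq p q; lia. Qed.

Lemma size_sub_leq (p q : {poly rat}) a :
  (size p <= a -> size q <= a -> size (p - q)%R <= a)%N.
Proof.
move=> hp hq; apply: leq_trans (size_polyD _ _) _.
by rewrite size_polyN geq_max hp hq.
Qed.

Section Constituents.
Variables (A : nat -> {poly rat}) (c d : nat).
Hypotheses (specA : forall a, antidiff_spec (A a) a)
  (A1 : A 1%N = 2^-1 *: ('X^2 + 'X)) (d_gt0 : (0 < d)%N).

Definition scaled_var : {poly rat} := d%:R^-1 *: 'X.
Local Notation x := scaled_var.

(** At [n = k * d + r] this is the sum of [(l + r / d) ^ a] over [l <= k]. The residue enters only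
    the constant term. *)
Definition shifted_sum_poly (r a : nat) : {poly rat} :=
  (A a \Po x) - (A a).[r%:R / d%:R - 1]%:P.

Definition moment_poly (r e : nat) : {poly rat} :=
  \sum_(b < e.+1) ((-1) ^+ b * 'C(e, b)%:R) *: (x ^+ (e - b) *
    ((d%:R * (d%:R - c%:R)) *: (x * shifted_sum_poly r b.+1) +
     (c%:R * d%:R) *: shifted_sum_poly r b.+2)).

(* Reversing the sum, [t = k - l], and writing [xi = n / d = k + rho], the three
   factors become [(d - c) xi + c (l + rho)], [d (l + rho)] and
   [xi - (l + rho)]: the residue enters only through power sums of [l + rho]. *)
Lemma moment_polyE k r e (n := (k * d + r)%N) :
  (moment_poly r e).[n%:R] =
  \sum_(t < k.+1) (n%:R - t%:R * c%:R) * (n%:R - t%:R * d%:R) * t%:R ^+ e.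
Proof.
pose rho : rat := r%:R / d%:R; pose xi : rat := k%:R + rho.
have dN0 : d%:R != 0 :> rat by rewrite pnatr_eq0 -lt0n.
have xE : x.[n%:R] = xi.
  by rewrite /scaled_var !hornerE /n natrD natrM /xi /rho; field.
have nE : n%:R = d%:R * xi by rewrite /n natrD natrM /xi /rho; field.
have SE a : (shifted_sum_poly r a).[n%:R] = \sum_(l < k.+1) (l%:R + rho) ^+ a.
  rewrite /shifted_sum_poly hornerD hornerN hornerC horner_comp xE.
  by rewrite -(sum_shifted_powers _ _ (specA a)).
rewrite (reindex_inj rev_ord_inj) /=.
transitivity (\sum_(l < k.+1) \sum_(b < e.+1) (-1) ^+ b * 'C(e, b)%:R *
   (xi ^+ (e - b) * (d%:R * (d%:R - c%:R) * (xi * (l%:R + rho) ^+ b.+1) +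
     c%:R * d%:R * (l%:R + rho) ^+ b.+2))).
  rewrite exchange_big /moment_poly horner_sum; apply: eq_bigr => b _.
  rewrite hornerZ hornerM horner_exp xE hornerD !hornerZ hornerM xE !SE.
  by rewrite !mulr_sumr -big_split /= !mulr_sumr.
apply: eq_bigr => l _; rewrite subSS natrB ?leq_ord // nE.
rewrite (_ : k%:R - l%:R = xi - (l%:R + rho)); last by rewrite /xi; ring.
move: (l%:R + rho) => y; rewrite exprBn mulr_sumr; apply: eq_bigr => b _.
by rewrite -mulr_natr !exprS; ring.
Qed.

(** Represents the sum of the [i.+1]-st powers of the line sizes. For [i = 0] the second difference
    of [t] vanishes and only the correction at [t = 0] remains. *)
Definition power_sum_poly r i : {poly rat} :=
  if i is m.+1 then
    \sum_(e < m.+1) ('C(m.+2, e)%:R * (1 + (-1) ^+ (m + e))) *: moment_poly r e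
    - (-1) ^+ m *: 'X^2
  else 'X^2.

Lemma second_diff_expand m (t : rat) :
  (t + 1) ^+ m.+2 - 2 * t ^+ m.+2 + (t - 1) ^+ m.+2 =
  \sum_(e < m.+1) ('C(m.+2, e)%:R * (1 + (-1) ^+ (m + e))) * t ^+ e.
Proof.
have expand (z : rat) : (t + z) ^+ m.+2 =
    \sum_(e < m.+1) ('C(m.+2, e)%:R * z ^+ (m.+2 - e)) * t ^+ e +
    m.+2%:R * z * t ^+ m.+1 + t ^+ m.+2.
  rewrite addrC exprDn big_ord_recr big_ord_recr /= subnn subSnn binn binSn.
  rewrite mulr1n expr0 mul1r expr1 -[_ *+ m.+2]mulr_natl mulrA; congr (_ + _ + _).
  by apply: eq_bigr => e _; rewrite -mulr_natl mulrA.
rewrite !expand [\sum_(_ < _) _ * _](eq_bigr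
  (fun e : 'I_m.+1 => 'C(m.+2, e)%:R * t ^+ e)) => [|e _]; last first.
  by rewrite expr1n mulr1.
rewrite [\sum_(_ < _) _ * (-1) ^+ _ * _](eq_bigr
  (fun e : 'I_m.+1 => 'C(m.+2, e)%:R * (-1) ^+ (m + e) * t ^+ e)) => [|e _]; last first.
  congr (_ * _ * _); rewrite -signr_odd -[RHS]signr_odd; congr (_ ^+ nat_of_bool _).
  by have := ltn_ord e; lia.
rewrite [RHS](eq_bigr (fun e : 'I_m.+1 => 'C(m.+2, e)%:R * (-1) ^+ (m + e) * t ^+ e +
  'C(m.+2, e)%:R * t ^+ e)) ?big_split /= => [|e _]; last by ring.
have cancel (u v a y z : rat) :
    u + a * 1 * y + z - 2 * z + (v + a * -1 * y + z) = v + u by ring.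
exact: cancel.
Qed.

Lemma power_sum_polyE k r i (n := (k * d + r)%N) :
  (power_sum_poly r i).[n%:R] =
  \sum_(t < k.+1) (n%:R - t%:R * c%:R) * (n%:R - t%:R * d%:R) *
     (t.+1%:R ^+ i.+1 - 2 * t%:R ^+ i.+1 + (t%:R - 1) ^+ i.+1)
  - (-1) ^+ i.+1 * n%:R ^+ 2.
Proof.
case: i => [|m] /=.
  rewrite big1 => [|t _]; first by rewrite hornerXn expr1 mulN1r opprK add0r.
  by rewrite -(natr1 t); ring.
under [in RHS]eq_bigr => t _ do rewrite -(natr1 t) second_diff_expand mulr_sumr.
rewrite exchange_big /= hornerD hornerN hornerZ hornerXn horner_sum.
congr (_ - _); last by rewrite !exprS; ring.
apply: eq_bigr => e _; rewrite hornerZ moment_polyE mulr_sumr.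
by apply: eq_bigr => t _; rewrite mulrCA.
Qed.

(** This is [indep_weight_rec] solved for the weight at [q.+1]. The inner conditional is
    [count_poly r q'], inlined to keep the recursion structural. *)
Fixpoint weight_poly r q i : {poly rat} :=
  if q is q'.+1 then
    (if q' is 0 then 1 else q'%:R^-1 *: weight_poly r q' 0) * power_sum_poly r i
    - weight_poly r q' i.+1
  else 0.

Definition count_poly r q : {poly rat} :=
  if q is 0 then 1 else q%:R^-1 *: weight_poly r q 0.

Lemma weight_polyS r q i : weight_poly r q.+1 i =
  count_poly r q * power_sum_poly r i - weight_poly r q i.+1.
Proof. by []. Qed.

(** * Degree bounds *)

Lemma size_x_exp m : (size (x ^+ m) <= m.+1)%N.
Proof.
by rewrite exprZn; apply: leq_trans (size_scale_leq _ _) _; rewrite size_polyXn.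
Qed.

Lemma size_shifted_sum_poly r a : (size (shifted_sum_poly r a) <= a.+2)%N.
Proof.
apply: size_sub_leq; last by apply: leq_trans (size_polyC_leq1 _) _.
have dN0 : d%:R^-1 != 0 :> rat by rewrite invr_eq0 pnatr_eq0 -lt0n.
rewrite size_comp_poly2 ?(specA a).1 //.
by rewrite size_scale // size_polyX.
Qed.

Lemma size_moment_poly r e : (size (moment_poly r e) <= e + 4)%N.
Proof.
apply: leq_trans (size_sum _ _ _) _; apply/bigmax_leqP => b _.
apply: leq_trans (size_scale_leq _ _) _.
have -> : (e + 4 = (e - b) + (b + 4))%N by have := ltn_ord b; lia.
apply: size_prod_leq; first exact: size_x_exp.
apply: leq_trans (size_polyD _ _) _; rewrite geq_max; apply/andP; split.
  apply: leq_trans (size_scale_leq _ _) _.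
  rewrite [X in (_ <= X)%N](_ : _ = 1 + b.+3)%N; last by lia.
  apply: size_prod_leq; last exact: size_shifted_sum_poly.
  by have := size_x_exp 1; rewrite expr1.
apply: leq_trans (size_scale_leq _ _) _.
by apply: leq_trans (size_shifted_sum_poly _ _) _; lia.
Qed.

Lemma size_power_sum_poly r i : (size (power_sum_poly r i) <= i + 3)%N.
Proof.
case: i => [|m] /=; first by rewrite size_polyXn.
apply: size_sub_leq; last first.
  by apply: leq_trans (size_scale_leq _ _) _; rewrite size_polyXn; lia.
apply: leq_trans (size_sum _ _ _) _; apply/bigmax_leqP => e _.
apply: leq_trans (size_scale_leq _ _) _.
by apply: leq_trans (size_moment_poly _ _) _; have := ltn_ord e; lia.
Qed.

Lemma size_weight_count_poly r q :
  (forall i, (size (weight_poly r q i) <= 2 * q + i + 1)%N) /\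
  (size (count_poly r q) <= 2 * q + 1)%N.
Proof.
elim: q => [|q [IHv IHe]]; first by rewrite size_poly1; split=> // i; rewrite size_poly0.
suff Hv i : (size (weight_poly r q.+1 i) <= 2 * q.+1 + i + 1)%N.
  split=> //; apply: leq_trans (size_scale_leq _ _) _.
  by rewrite -[X in (_ <= X + 1)%N]addn0.
rewrite weight_polyS; apply: size_sub_leq.
  rewrite [X in (_ <= X)%N](_ : _ = 2 * q + (i + 3))%N; last by lia.
  apply: size_prod_leq; last exact: size_power_sum_poly.
  by rewrite -addn1.
by apply: leq_trans (IHv _) _; lia.
Qed.

(** * Dependence of the polynomials on the residue *)

Definition period_defect r i := power_sum_poly r i - power_sum_poly 0 i.

Lemma moment_poly_defect r e :
  moment_poly r e - moment_poly 0 e =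
  \sum_(b < e.+1) ((-1) ^+ b * 'C(e, b)%:R) *: (x ^+ (e - b) *
    ((d%:R * (d%:R - c%:R)) *:
       (x * ((A b.+1).[-1] - (A b.+1).[r%:R / d%:R - 1])%:P) +
     (c%:R * d%:R) *: ((A b.+2).[-1] - (A b.+2).[r%:R / d%:R - 1])%:P)).
Proof.
have dS a : shifted_sum_poly r a - shifted_sum_poly 0 a =
    ((A a).[-1] - (A a).[r%:R / d%:R - 1])%:P.
  rewrite /shifted_sum_poly mul0r sub0r opprB addrC addrA subrK.
  by rewrite -rmorphB.
rewrite -sumrB; apply: eq_bigr => b _.
by rewrite -scalerBr -mulrBr opprD addrACA -!scalerBr -mulrBr !dS.
Qed.

Lemma size_moment_poly_defect r e :
  (size (moment_poly r e - moment_poly 0 e)%R <= e + 2)%N.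
Proof.
rewrite moment_poly_defect; apply: leq_trans (size_sum _ _ _) _.
apply/bigmax_leqP => b _; apply: leq_trans (size_scale_leq _ _) _.
apply: leq_trans (_ : (e - b + 2 <= _)%N); last by lia.
apply: size_prod_leq; first exact: size_x_exp.
apply: leq_trans (size_polyD _ _) _; rewrite geq_max; apply/andP; split.
  apply: leq_trans (size_scale_leq _ _) _; apply: (@size_prod_leq _ _ 1 1).
    by have := size_x_exp 1; rewrite expr1.
  exact: size_polyC_leq1.
apply: leq_trans (size_scale_leq _ _) _.
by apply: leq_trans (size_polyC_leq1 _) _.
Qed.

Lemma period_defect0 r : period_defect r 0 = 0.
Proof. exact: subrr. Qed.

Lemma size_period_defect r i : (size (period_defect r i) <= i + 1)%N.
Proof.
rewrite /period_defect; case: i => [|m] /=; first by rewrite subrr size_poly0.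
rewrite opprD addrACA subrr addr0 -sumrB.
apply: leq_trans (size_sum _ _ _) _; apply/bigmax_leqP => e _.
rewrite -scalerBr; apply: leq_trans (size_scale_leq _ _) _.
by apply: leq_trans (size_moment_poly_defect _ _) _; have := ltn_ord e; lia.
Qed.

(** Only [e = b = 0] occurs, and its [A 2] part is constant. The linear part comes from [A 1], which
    is 0 at [-1] and [- rho * (1 - rho) / 2] at [rho - 1]. *)
Lemma coef1_period_defect r (rho : rat := r%:R / d%:R) :
  (period_defect r 1)`_1 = (d%:R - c%:R) * (rho * (1 - rho)).
Proof.
rewrite /period_defect /= !big_ord1 opprD addrACA subrr addr0 -scalerBr.
rewrite moment_poly_defect big_ord1 expr0 !mul1r A1.
rewrite !coefZ mul1r coefD !coefZ coefMC !coefZ coefX coefC /=.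
rewrite !hornerZ !hornerD !hornerXn !hornerX -/rho.
have dN0 : d%:R != 0 :> rat by rewrite pnatr_eq0 -lt0n.
by field.
Qed.

Lemma coefM_top (p q : {poly rat}) a b :
  (size p <= a.+1)%N -> (size q <= b.+1)%N -> (p * q)`_(a + b) = p`_a * q`_b.
Proof.
move=> hp hq; have lt_a : (a < (a + b).+1)%N by lia.
rewrite coefM (bigD1 (Ordinal lt_a)) //= addKn big1 ?addr0 // => i neq_ia.
have {}neq_ia : (i != a :> nat) by apply: contraNneq neq_ia => e; apply/eqP/val_inj.
have [lt_ia|lt_ai] := ltnP i a; last by rewrite (nth_default _ (s := p)) ?mul0r //; lia.
by rewrite [X in _ * X]nth_default ?mulr0 //; apply: leq_trans hq _; lia.
Qed.

Lemma weight_poly_defect r q i :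
  weight_poly r q.+1 i - weight_poly 0 q.+1 i =
  (count_poly r q - count_poly 0 q) * power_sum_poly r i +
  count_poly 0 q * period_defect r i -
  (weight_poly r q i.+1 - weight_poly 0 q i.+1).
Proof. by rewrite !weight_polyS /period_defect; ring. Qed.

Lemma count_poly_defect r q :
  count_poly r q - count_poly 0 q =
  q%:R^-1 *: (weight_poly r q 0 - weight_poly 0 q 0).
Proof. by case: q => [|q]; rewrite ?subrr ?scaler0 // -scalerBr. Qed.

(** Compared with the degree bound [2 * q + i] of the weights, the difference loses at least two
    degrees. For [i = 0] it loses a third, since the dominant term contains
    [period_defect r 0 = 0]. *)
Lemma size_defect r q :
  (forall i, (size (weight_poly r q i - weight_poly 0 q i)%R <= 2 * q + i - 1)%N) /\
  (size (weight_poly r q 0 - weight_poly 0 q 0)%R <= 2 * q - 2)%N.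
Proof.
elim: q => [|q [IH IH0]]; first by rewrite subrr size_poly0.
have size_M i :
    (size ((count_poly r q - count_poly 0 q) * power_sum_poly r i)%R <= 2 * q + i)%N.
  rewrite count_poly_defect; case: q IH0 {IH} => [|q] IH0.
    by rewrite subrr scaler0 mul0r size_poly0.
  rewrite mulrC [X in (_ <= X)%N](_ : _ = (i + 2) + (2 * q))%N; last by lia.
  apply: size_prod_leq; first by rewrite -addnS size_power_sum_poly.
  by apply: leq_trans (size_scale_leq _ _) _; apply: leq_trans IH0 _; lia.
split=> [i|]; rewrite weight_poly_defect; apply: size_sub_leq.
- apply: leq_trans (size_polyD _ _) _; rewrite geq_max; apply/andP; split.
    by apply: leq_trans (size_M _) _; lia.
  rewrite [X in (_ <= X)%N](_ : _ = 2 * q + (i + 1))%N; last by lia.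
  apply: size_prod_leq; last exact: size_period_defect.
  by have [_] := size_weight_count_poly 0 q; rewrite addn1.
- by apply: leq_trans (IH _) _; lia.
- by rewrite period_defect0 mulr0 addr0; apply: leq_trans (size_M _) _; lia.
- by apply: leq_trans (IH _) _; lia.
Qed.

(** At top degree the recursion reduces to multiplication by ['X^2] and division by [q.+1], so the
    coefficient is [1 / q!]. *)
Lemma coef_count_poly_gt0 r q : 0 < (count_poly r q)`_(2 * q).
Proof.
elim: q => [|q IH]; first by rewrite coefC.
have [szw _] := size_weight_count_poly r q.
rewrite coefZ weight_polyS coefB [X in _ - X]nth_default; last first.
  by apply: leq_trans (szw _) _; lia.
by rewrite subr0 coefMXn mulnS /= add2n /= subn2 /= mulr_gt0 ?invr_gt0 ?ltr0n.
Qed.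

Lemma coef_weight_poly_defect r q :
  (weight_poly r q.+1 1 - weight_poly 0 q.+1 1)`_(2 * q + 1) =
  (count_poly 0 q)`_(2 * q) * (period_defect r 1)`_1.
Proof.
have [szw szw0] := size_defect r q.
rewrite weight_poly_defect coefB coefD [X in _ - X]nth_default; last first.
  by apply: leq_trans (szw _) _; lia.
rewrite [X in X + _ - _]nth_default; last first.
  rewrite count_poly_defect; case: q szw0 {szw} => [|q] szw0.
    by rewrite subrr scaler0 mul0r size_poly0.
  rewrite mulrC [X in (_ <= X)%N](_ : _ = 3 + (2 * q))%N; last by lia.
  apply: size_prod_leq; first exact: size_power_sum_poly.
  by apply: leq_trans (size_scale_leq _ _) _; apply: leq_trans szw0 _; lia.
rewrite subr0 add0r coefM_top ?size_period_defect //.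
by have [_] := size_weight_count_poly 0 q; rewrite addn1.
Qed.

(** Unfolding the recursion twice gives, up to a positive factor, the previous such coefficient (0
    at the start) minus a positive product; negativity follows by induction. *)
Lemma coef_count_poly_defect_lt0 r q : 0 < (period_defect r 1)`_1 ->
  (count_poly r q.+2 - count_poly 0 q.+2)`_(2 * q + 1) < 0.
Proof.
move=> defect_gt0; have step m :
    (count_poly r m.+2 - count_poly 0 m.+2)`_(2 * m + 1) = m.+2%:R^-1 *
    ((if m is m'.+1 then (count_poly r m'.+2 - count_poly 0 m'.+2)`_(2 * m' + 1) else 0)
     - (count_poly 0 m)`_(2 * m) * (period_defect r 1)`_1).
  rewrite count_poly_defect coefZ weight_poly_defect coefB coef_weight_poly_defect.
  rewrite period_defect0 mulr0 addr0 coefMXn; congr (_ * (_ - _)).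
  case: m => [//|m]; rewrite ifF; last by lia.
  by congr (_`_ _); lia.
have sign m (u : rat) : u <= 0 ->
    m.+2%:R^-1 * (u - (count_poly 0 m)`_(2 * m) * (period_defect r 1)`_1) < 0.
  move=> u_le0; rewrite pmulr_rlt0 ?invr_gt0 ?ltr0n // subr_lt0.
  by apply: le_lt_trans u_le0 _; rewrite mulr_gt0 ?coef_count_poly_gt0.
elim: q => [|q IH]; rewrite step; apply: sign => //.
exact: ltW.
Qed.

End Constituents.

(** * The period *)

Section CountingPolynomials.
Variables (A : nat -> {poly rat}) (c d k r n : nat).
Hypotheses (specA : forall a, antidiff_spec (A a) a)
  (le_cd : (c <= d)%N) (lt_rd : (r < d)%N) (co_cd : coprime c d) (nE : n = (k * d + r)%N).

(** Both sides obey the same recursion. The induction covers all [i] at once, as the step to [q.+1]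
    raises the exponent. *)
Lemma weight_count_polyE q :
  (forall i, (weight_poly A c d r q i).[n%:R] =
     (indep_weight (@line c d n) q i)%:R) /\
  (count_poly A c d r q).[n%:R] = (indep_count (@line c d n) q)%:R.
Proof.
have d_gt0 : (0 < d)%N by lia.
elim: q => [|q [IHw IHc]].
  split=> [i|]; first by rewrite indep_weight0 horner0.
  by rewrite hornerC indep_count0.
suff Hw i : (weight_poly A c d r q.+1 i).[n%:R] =
    (indep_weight (@line c d n) q.+1 i)%:R.
  split=> //; rewrite /count_poly hornerZ Hw indep_weight_exp0 natrM mulKf //.
  by rewrite pnatr_eq0.
have PE : (power_sum_poly A c d r i).[n%:R] =
    (\sum_z csize (@line c d n) z ^ i)%N%:R.
  rewrite natr_sum nE; apply: etrans (esym (power_sum_csize _ _ le_cd lt_rd co_cd)).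
  exact: power_sum_polyE.
rewrite weight_polyS hornerD hornerN hornerM IHc IHw PE.
by rewrite -natrM indep_weight_rec natrD addrK.
Qed.

Lemma count_polyE q :
  (count_poly A c d r q).[n%:R] = (u_rider c%:Z d%:Z q n)%:R.
Proof. by rewrite u_riderE //; [case: (weight_count_polyE q) | lia]. Qed.

End CountingPolynomials.

Lemma u_rider_period_nat (c d q : nat) :
    (c <= d)%N -> coprime c d -> (2 <= q)%N ->
  quasipoly_period (u_rider c%:Z d%:Z q) d.
Proof.
move=> le_cd co; case: q => [|[|q]] // _.
have d_gt0 : (0 < d)%N.
  by case: (d) le_cd co => //; rewrite leqn0 => /eqP ->.
have [A [specA A1]] := antidiff_family.
split=> [|p [p_gt0 [G GE]]].
  split=> //; exists (fun r => count_poly A c d r q.+2) => n _.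
  by rewrite -(count_polyE specA le_cd (ltn_pmod n d_gt0) co (divn_eq n d)).
rewrite leqNgt; apply/negP => lt_pd.
have constituent r : (r < d)%N -> (p %| r)%N -> count_poly A c d r q.+2 = G 0%N.
  move=> lt_rd p_r.
  (* These points are [r] mod [d] and 0 mod [p]; [m.+1] keeps them positive, as [GE] requires. *)
  apply: (@poly_eq_infinite _ _ (fun m => (m.+1 * p * d + r)%N%:R)) => [m m'|m].
    by move=> /eqP; rewrite eqr_nat eqn_add2r !eqn_pmul2r // => /eqP[].
  rewrite (count_polyE specA le_cd lt_rd co erefl) GE; last first.
    by rewrite addn_gt0 !muln_gt0 p_gt0 d_gt0.
  congr (G _).[_]; apply/eqP; rewrite -/(dvdn _ _) dvdn_add //.
  by rewrite -mulnA mulnCA dvdn_mulr.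
suff : (count_poly A c d p q.+2 - count_poly A c d 0 q.+2)`_(2 * q + 1) < 0.
  by rewrite !constituent // subrr coef0 ltxx.
apply: coef_count_poly_defect_lt0 => //.
rewrite coef1_period_defect //.
have d_pos : 0 < d%:R :> rat by rewrite ltr0n.
rewrite !mulr_gt0 ?subr_gt0 ?invr_gt0 ?ltr0n ?ltr_nat //; last first.
  by rewrite ltr_pdivrMr // mul1r ltr_nat.
(* If [c = d], coprimality forces [d = 1], leaving no room for [0 < p < d]. *)
rewrite ltn_neqAle le_cd andbT; apply: contraTneq co => ->.
by rewrite /coprime gcdnn; lia.
Qed.

(** * Symmetries of the board and reduction to nonnegative moves *)

Lemma u_rider_inj (c d c' d' : int) (q n : nat) (f : square n -> square n) :
    injective f ->
    (forall z z', attacks c' d' (f z) (f z') <-> attacks c d z z') ->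
  u_rider c d q n = u_rider c' d' q n.
Proof.
move=> finj fP; rewrite /u_rider -[RHS](card_preimset _ (imset_inj finj)).
apply: eq_card => S; rewrite !inE; apply: asbool_equiv_eq.
rewrite /nonattacking (card_imset _ finj).
split=> -[cS nS]; split=> //.
  move=> _ _ /imsetP[z zS ->] /imsetP[z' zS' ->] nzz' /fP.
  by apply: nS => //; apply: contraNneq nzz' => ->.
move=> z z' zS zS' nzz' /fP; apply: nS; rewrite ?imset_f //.
by rewrite (inj_eq finj).
Qed.

Lemma u_rider_swap (c d : int) q : u_rider c d q = u_rider d c q.
Proof.
apply/funext => n; apply: (@u_rider_inj _ _ _ _ _ _ (fun z => (z.2, z.1))).
  by move=> [x y] [x' y'] [-> ->].
by move=> z z'; split=> -[k [e1 e2]]; exists k.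
Qed.

Lemma u_riderNl (c d : int) q : u_rider (- c) d q = u_rider c d q.
Proof.
apply/funext => n; apply: (@u_rider_inj _ _ _ _ _ _ (fun z => (rev_ord z.1, z.2))).
  move=> [x y] [x' y'] e.
  by rewrite (rev_ord_inj (congr1 fst e) : x = x') (congr1 snd e : y = y').
move=> [x y] [x' y']; have ltx := ltn_ord x; have ltx' := ltn_ord x'.
by split=> -[k /= [e1 e2]]; exists k; split=> //=; lia.
Qed.

Lemma u_rider_abs (c d : int) q :
  u_rider c d q = u_rider `|c|%N%:Z `|d|%N%:Z q.
Proof.
have absl (a b : int) : u_rider a b q = u_rider `|a|%N%:Z b q.
  by case: a => // a; rewrite NegzE u_riderNl abszN.
by rewrite absl u_rider_swap absl u_rider_swap.
Qed.

Local Close Scope ring_scope.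

Theorem theorem4p2 (c d : int) (q : nat) :
  gcdz c d = 1 -> (2 <= q)%N ->
  quasipoly_period (u_rider c d q) (maxn `|c|%N `|d|%N).
Proof.
move=> [co] q_ge2; rewrite u_rider_abs.
have [le_cd|/ltnW le_dc] := leqP `|c| `|d|.
  by apply: u_rider_period_nat => //; rewrite /coprime co.
by rewrite u_rider_swap; apply: u_rider_period_nat => //; rewrite /coprime gcdnC co.
Qed.
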